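(* Let $n\ge 2$ and let $f:\Gamma\to\mathbb{R}$ be a smooth symmetric function on the cone $\Gamma\subsetneq\mathbb{R}^n$. Assume that $f$ is concave in $\Gamma$ and that $\lim_{t\to+\infty}f(t\lambda)>-\infty$ for every $\lambda\in\Gamma_n$. Let $\mathcal{S}$ be a symmetric subset of $\{\lambda\in\Gamma: f(\lambda)<\sup_\Gamma f\}$ such that $\partial\Gamma^\sigma\subseteq\mathcal{S}$ for some $\sigma\in(\sup_{\partial\Gamma}f,\ \sup_\Gamma f)$. Then $$\mathcal{C}^{\mathfrak m}_{\mathcal{S},f}=\overline{\Gamma_{\mathcal{G}}^{f}}.$$
   Context: $\Gamma\subsetneq\mathbb{R}^n$ is an open convex cone with vertex at the origin, symmetric (invariant under permutations of coordinates), with nonempty boundary $\partial\Gamma$, and containing the positive cone $\Gamma_n=\{\lambda\in\mathbb{R}^n:\text{each }\lambda_i>0\}$. A subset is symmetric if it is invariant under permutations of coordinates. Write $f_i=\partial f/\partial\lambda_i$. $\sup_{\partial\Gamma}f=\sup_{\lambda^0\in\partial\Gamma}\limsup_{\lambda\to\lambda^0}f(\lambda)$ (with $\lambda\in\Gamma$). For $\sigma\in(\sup_{\partial\Gamma}f,\sup_\Gamma f)$, $\partial\Gamma^\sigma=\{\lambda\in\Gamma: f(\lambda)=\sigma\}$. Maximal test cone of $(f,\mathcal{S})$: $\mathcal{C}^{\mathfrak m}_{\mathcal{S},f}=\{\mu\in\mathbb{R}^n:\sum_{i=1}^n f_i(\lambda)\mu_i\ge 0\ \text{ for all }\lambda\in\mathcal{S}\}$.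 Asymptotical cone: $\Gamma_{\mathcal{G}}^{f}=\{\lambda\in\Gamma:\lim_{t\to+\infty}f(t\lambda)>-\infty\}$; $\overline{\Gamma_{\mathcal{G}}^{f}}$ is its closure in $\mathbb{R}^n$. *)

(* Defs.v *)
From HB Require Import structures.
From mathcomp Require Import all_boot all_order all_algebra all_fingroup.
From mathcomp Require Import all_classical all_reals all_analysis.

Set Implicit Arguments.
Unset Strict Implicit.
Unset Printing Implicit Defensive.

Import Order.TTheory GRing.Theory Num.Theory.
Import numFieldNormedType.Exports.

Local Open Scope classical_set_scope.
Local Open Scope ring_scope.

(* Vectors of R^n are row vectors 'rV[R]_n.  A function f on an open set G is
   represented by a total function 'rV[R]_n -> R: no definition below depends on
   its values outside G as long as the points considered lie in G. *)

Section SymmetricFunctionsOnCones.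
Context {R : realType} {n : nat}.
Implicit Types (A G S : set 'rV[R]_n) (f : 'rV[R]_n -> R).

Definition boundary A : set 'rV[R]_n := closure A `\` interior A.

Definition is_cone A := forall (t : R) x, 0 < t -> A x -> A (t *: x).

Definition symmetric_set A := forall (s : 'S_n) x, A x -> A (col_perm s x).

Definition symmetric_fun G f :=
  forall (s : 'S_n) x, G x -> f (col_perm s x) = f x.

Definition positive_cone : set 'rV[R]_n := [set x | forall i, 0 < x 0 i].

Definition concave_function G f := convex_function G (\- f).

Definition partial (i : 'I_n) f : 'rV[R]_n -> R := 'D_(delta_mx 0 i) f.

Definition iter_partial (s : seq 'I_n) f : 'rV[R]_n -> R := foldr partial f s.

(* C^oo on the open set G: the partial derivatives of all orders exist and are
   continuous at every point of G. *)
Definition smooth_on G f := forall (s : seq 'I_n) x, G x ->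
  {for x, continuous (iter_partial s f)} /\
  forall i, derivable (iter_partial s f) x (delta_mx 0 i).

Local Open Scope ereal_scope.

Definition sup_on G f : \bar R := ereal_sup [set (f x)%:E | x in G].

Definition sup_boundary G f : \bar R :=
  ereal_sup [set limf_esup (fun x => (f x)%:E) (within G (nbhs x0))
            | x0 in boundary G].

Definition level_set G f (sigma : R) : set 'rV[R]_n :=
  [set x | G x /\ f x = sigma].

(* The limit of f (t x) as t -> +oo exists in the extended reals and is
   not -oo; +oo is allowed. *)
Definition ray_lim_gtNy f (x : 'rV[R]_n) : Prop :=
  exists2 l : \bar R, (f (t *: x)%R)%:E @[t --> +oo%R] --> l & -oo < l.

Definition asymptotical_cone G f : set 'rV[R]_n :=
  [set x | G x /\ ray_lim_gtNy f x].

Definition maximal_test_cone S f : set 'rV[R]_n :=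
  [set mu | forall x, S x -> (0 <= \sum_(i < n) partial i f x * mu ord0 i)%R].

End SymmetricFunctionsOnCones.

(* Main.v *)
Require Import Defs.
From HB Require Import structures.
From mathcomp Require Import all_boot all_order all_algebra all_fingroup.
From mathcomp Require Import all_classical all_reals all_analysis.
From mathcomp Require Import ring lra.
Import Order.TTheory GRing.Theory Num.Theory.
Import numFieldNormedType.Exports.
Local Open Scope classical_set_scope.
Local Open Scope ring_scope.

(** Write <grad f(x), mu> for the pairing in the definition of the test cone.

    The first ingredient is the gradient inequality
    f(y) <= f(x) + <grad f(x), y - x> of a concave function on an open convex
    set ([supergradient_le]).

    Closure inside test cone.  If f(t l) stays bounded below as t -> +oo, the
    gradient inequality at any x of G, applied to y = t l, forces
    <grad f(x), l> >= 0 ([grad_pair_ge0_of_ray_ge]); the test cone, being cut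
    out by such closed conditions, contains the closure of the asymptotical
    cone.  The same inequality makes f nondecreasing along l, so that the limit
    along a ray exists and is not -oo as soon as f is bounded below far out on
    the ray ([ray_lim_gtNyP]).

    Test cone inside closure.  Let mu pair nonnegatively with the gradient on
    the level set {f = sigma}.  Since sigma lies above the boundary values of f,
    {f >= sigma} is closed in the whole space ([closed_superlevel]).  A half
    line issued from a point x where f(x) > sigma, of direction mu, can
    therefore leave {f >= sigma} only through a point z = x + m mu of the level
    set; but there f(x) <= f(z) - m <grad f(z), mu> <= sigma, a contradiction.
    So the half line never leaves ([ray_in_superlevel]).  Moving a point of
    {f > sigma} far enough in the direction (1, ..., 1) keeps it in {f > sigma}
    and makes it a positive vector x; then f(s x) > sigma for all s >= 1, again
    by monotonicity.  Hence f(s x + t mu) >= sigma for all s >= 1 and t >= 0,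
    which for every e > 0 puts mu + e x in the asymptotical cone; let e tend
    to 0. *)

Section ConcaveFunctions.
Set Implicit Arguments.
Unset Strict Implicit.
Unset Printing Implicit Defensive.
Context {R : realType} {n : nat}.
Implicit Types (G : set 'rV[R]_n) (f : 'rV[R]_n -> R) (x y mu : 'rV[R]_n).

Definition grad_pair f x mu : R := \sum_(i < n) partial i f x * mu ord0 i.

Lemma grad_pairD f x mu nu :
  grad_pair f x (mu + nu) = grad_pair f x mu + grad_pair f x nu.
Proof.
by rewrite /grad_pair -big_split; apply: eq_bigr => i _; rewrite mxE mulrDr.
Qed.

Lemma grad_pairZ f x c mu : grad_pair f x (c *: mu) = c * grad_pair f x mu.
Proof.
by rewrite /grad_pair mulr_sumr; apply: eq_bigr => i _; rewrite mxE mulrCA.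
Qed.

Lemma grad_pair_continuous f x : continuous (grad_pair f x).
Proof.
move=> mu; apply: (cvg_big add_continuous (F := nbhs mu)) => i _.
by apply: cvgM; [exact: cvg_cst|exact: coord_continuous].
Qed.

(** * Jensen's inequality for arithmetic means *)

Lemma convex_set_mem G (t : R) x y : convex_set G -> 0 <= t -> t <= 1 ->
  G x -> G y -> G (t *: x + (1 - t) *: y).
Proof.
move=> Gcvx t0 t1 Gx Gy.
by have := Gcvx x y (Itv01 t0 t1) (mem_set Gx) (mem_set Gy); rewrite inE.
Qed.

Lemma concave_function_ge G f (t : R) x y :
  concave_function G f -> 0 <= t -> t <= 1 -> G x -> G y ->
  t * f x + (1 - t) * f y <= f (t *: x + (1 - t) *: y).
Proof.
move=> fcc t0 t1 Gx Gy.
have := fcc (Itv01 t0 t1) x y (mem_set Gx) (mem_set Gy).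
by rewrite -lerN2 convN /= !opprK.
Qed.

(** Membership of the mean and the inequality are proved together: the mean of
    k + 1 points is the convex combination, of weights 1 / (k + 1) and
    k / (k + 1), of one of them and of the mean of the k others. *)
Lemma concave_function_mean G f (I : Type) (r : seq I) (F : I -> 'rV[R]_n) :
  convex_set G -> concave_function G f -> (forall i, G (F i)) ->
  (0 < size r)%N ->
  let m := (size r)%:R^-1 *: \sum_(i <- r) F i in
  G m /\ (size r)%:R^-1 * \sum_(i <- r) f (F i) <= f m.
Proof.
move=> Gcvx fcc GF; elim: r => // i s IH _ /=.
have [/size0nil ->|s_gt0] := posnP (size s).
  by rewrite /= !big_seq1 invr1 scale1r mul1r; split.
have {IH} /= := IH s_gt0; rewrite !big_cons.
set k := size s; set S := \sum_(_ <- _) F _; set T := \sum_(_ <- _) f _.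
move=> [Gm fm]; have k0 : k%:R != 0 :> R by rewrite pnatr_eq0 -lt0n.
have kS0 : k.+1%:R != 0 :> R by rewrite pnatr_eq0.
have kSE : 1 - k.+1%:R^-1 = k.+1%:R^-1 * k%:R :> R.
  by apply: (mulfI kS0); rewrite mulrA mulrBr !divff// mulr1 mul1r -natr1 addrK.
have t0 : 0 <= k.+1%:R^-1 :> R by rewrite invr_ge0 ler0n.
have t1 : k.+1%:R^-1 <= 1 :> R by rewrite invf_le1 ?ltr0n// ler1n.
have -> : k.+1%:R^-1 *: (F i + S) =
    k.+1%:R^-1 *: F i + (1 - k.+1%:R^-1) *: (k%:R^-1 *: S).
  by rewrite scalerDr scalerA kSE mulfK.
split; first exact: convex_set_mem.
apply: le_trans (concave_function_ge fcc t0 t1 (GF i) Gm).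
by rewrite mulrDr lerD2l kSE -mulrA ler_wpM2l// -ler_pdivrMl ?ltr0n.
Qed.

(** * The gradient inequality *)

(** The factor c rescales the increment.  For c = 0 the quotient is constant;
    otherwise it is c times the difference quotient at c t. *)
Lemma cvg_diff_quotient_at_right f x mu (c : R) : derivable f x mu ->
  t^-1 * (f (x + (c * t) *: mu) - f x) @[t --> 0^'+] --> c * 'D_mu f x.
Proof.
move=> fxmu; have [->|c0] := eqVneq c 0.
  under eq_fun do rewrite mul0r scale0r addr0 subrr mulr0.
  by rewrite mul0r; exact: cvg_cst.
apply: cvg_dnbhs_at_right.
have ct : c * t @[t --> 0^'] --> (0 : R)^'.
  have ct0 : c * t @[t --> (0 : R)^'] --> (0 : R).
    rewrite -[X in _ --> X](mulr0 c); apply: cvgM; first exact: cvg_cst.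
    by apply: cvg_within.
  move=> A /ct0 cA; change (\forall t \near (0 : R)^', A (c * t)); near=> t.
  suff : c * t != 0 by near: t; exact: cA.
  by rewrite mulf_neq0//; near: t; exact: nbhs_dnbhs_neq.
have fct : c * ((c * t)^-1 * (f ((c * t) *: mu + x) - f x)) @[t --> (0 : R)^']
    --> c * 'D_mu f x.
  by apply: cvgM; [exact: cvg_cst|exact: cvg_comp ct fxmu].
apply: cvg_trans fct; apply: near_eq_cvg; near=> t.
have t0 : t != 0 by near: t; exact: nbhs_dnbhs_neq.
by rewrite [_ *: mu + x]addrC invfM !mulrA divff// mul1r.
Unshelve. all: by end_near. Qed.

(** The partial derivatives control f along the coordinate axes through x, and
    concavity carries this information to all directions.  With
    h = y - x, the point x - t h is the mean of the points x - n t h_i e_i, so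
    that Jensen's inequality bounds f(x - t h) from below by values of f on the
    axes; and x, lying between x - t h and y, satisfies
    t (f(y) - f(x)) <= f(x) - f(x - t h).  Divide by t and let t tend to 0. *)
Lemma supergradient_le G f x y : (0 < n)%N -> open G -> convex_set G ->
  concave_function G f -> (forall i, derivable f x (delta_mx 0 i)) ->
  G x -> G y -> f y <= f x + grad_pair f x (y - x).
Proof.
move=> n_gt0 Gop Gcvx fcc fx Gx Gy.
have n0 : n%:R != 0 :> R by rewrite pnatr_eq0 -lt0n.
pose c i := - (n%:R * (y - x) ord0 i).
pose p t i := x + (c i * t) *: delta_mx 0 i.
have cvg_means : - (\sum_(i < n) n%:R^-1 * (t^-1 * (f (p t i) - f x)))
    @[t --> 0^'+] --> grad_pair f x (y - x).
  have -> : grad_pair f x (y - x) =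
      - \sum_(i < n) n%:R^-1 * (c i * partial i f x).
    rewrite /grad_pair -sumrN; apply: eq_bigr => i _.
    by rewrite /c mulNr mulrN opprK -mulrA mulKf// mulrC.
  apply: cvgN; apply: (cvg_big add_continuous (F := (0 : R)^'+)) => i _.
  by apply: cvgM; [exact: cvg_cst|exact: cvg_diff_quotient_at_right].
rewrite addrC -lerBlDr; apply: (cvgr_to_ge cvg_means).
have pG : \forall t \near 0^'+, forall i, G (p t i).
  apply: filter_forall => i.
  have pi : p t i @[t --> (0 : R)^'+] --> x.
    apply: cvg_at_right_filter.
    have -> : x = p 0 i by rewrite /p mulr0 scale0r addr0.
    apply: cvgD; first exact: cvg_cst.
    by apply: cvgZr_tmp; apply: cvgM; [exact: cvg_cst|exact: cvg_id].
  by apply: pi; exact: open_nbhs_nbhs.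
near=> t.
have t0 : 0 < t by near: t; exact: nbhs_right_gt.
have pGt : forall i, G (p t i) by near: t.
have := @concave_function_mean G f _ (enum 'I_n) (p t) Gcvx fcc pGt.
rewrite size_enum_ord !big_enum /= => /(_ n_gt0).
have -> : n%:R^-1 *: (\sum_(i < n) p t i) = x - t *: (y - x).
  rewrite big_split /= sumr_const card_ord -[x *+ n]scaler_nat.
  rewrite scalerDr [_ *: (_ *: x)]scalerA mulVf// scale1r; congr (_ + _).
  rewrite [X in _ = - (t *: X)]row_sum_delta !scaler_sumr -sumrN.
  apply: eq_bigr => i _; rewrite !scalerA -scaleNr; congr (_ *: _).
  by rewrite /c mulNr mulrN mulrA mulKf// mulrC.
move=> [Gm fm].
set m := x - _ in Gm fm.
(* (1 + t) x = t y + (x - t (y - x)) *)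
have t10 : 1 + t != 0 by rewrite gt_eqF// addr_gt0.
have sE : 1 - t / (1 + t) = (1 + t)^-1 by field.
have s0 : 0 <= t / (1 + t) by rewrite divr_ge0// ltW// addr_gt0.
have s1 : t / (1 + t) <= 1 by rewrite ler_pdivrMr ?addr_gt0// mul1r lerDr.
have := concave_function_ge fcc s0 s1 Gy Gm.
have -> : (t / (1 + t)) *: y + (1 - t / (1 + t)) *: m = x.
  by rewrite sE; apply/rowP => i; rewrite !mxE; field.
rewrite sE => fxy.
have {}fxy : t * (f y - f x) <= f x - f m.
  have : t * f y + f m <= (1 + t) * f x.
    by rewrite -ler_pdivrMl ?addr_gt0// mulrDr mulrA [_ * t]mulrC.
  by lra.
rewrite -(ler_pM2l t0); apply: le_trans fxy _.
rewrite -!mulr_sumr sumrB sumr_const card_ord -[f x *+ n]mulr_natl.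
set T := \sum_(_ < _) _ in fm *.
have -> : t * - (n%:R^-1 * (t^-1 * (T - n%:R * f x))) = f x - n%:R^-1 * T.
  by field; rewrite n0 gt_eqF.
by lra.
Unshelve. all: by end_near. Qed.

(** * Behaviour along rays *)

Section OnOpenConvexSet.
Context (G : set 'rV[R]_n) (f : 'rV[R]_n -> R).
Context (n_gt0 : (0 < n)%N) (G_open : open G) (G_convex : convex_set G).
Context (f_concave : concave_function G f).
Context (f_derivable : forall x, G x -> forall i, derivable f x (delta_mx 0 i)).
Context (f_continuous : forall x, G x -> {for x, continuous f}).

(** A negative pairing would make the affine majorant of f at x, hence f itself,
    tend to -oo along the ray. *)
Lemma grad_pair_ge0_of_ray_ge l M x : G l -> is_cone G ->
  (\forall t \near +oo, M <= f (t *: l)) -> G x -> 0 <= grad_pair f x l.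
Proof.
move=> Gl Gcone fM Gx; rewrite leNgt; apply/negP => sl0.
near (pinfty_nbhs R) => t.
have t0 : 0 < t by near: t; exact: nbhs_pinfty_gt.
have ft : M <= f (t *: l) by near: t.
have := supergradient_le n_gt0 G_open G_convex f_concave
  (f_derivable Gx) Gx (Gcone _ _ t0 Gl).
rewrite grad_pairD grad_pairZ -scaleN1r grad_pairZ => /(le_trans ft).
have : (M - f x + grad_pair f x x) / grad_pair f x l < t.
  by near: t; apply: nbhs_pinfty_gt; rewrite num_real.
rewrite ltr_ndivrMr//.
by lra.
Unshelve. all: by end_near. Qed.

(** The gradient inequality is used at the far endpoint of the segment, to bound
    the value at its origin. *)
Lemma le_of_grad_pair_ge0 l x t : (forall y, G y -> 0 <= grad_pair f y l) ->
  0 <= t -> G x -> G (x + t *: l) -> f x <= f (x + t *: l).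
Proof.
move=> sl t0 Gx Gxt.
have := supergradient_le n_gt0 G_open G_convex f_concave
  (f_derivable Gxt) Gxt Gx.
rewrite opprD addNKr -scaleNr grad_pairZ mulNr.
by have := mulr_ge0 t0 (sl _ Gxt); lra.
Qed.

(** A lower bound far out on the ray is enough: it makes f nondecreasing along
    the ray, so that the limit exists automatically. *)
Lemma ray_lim_gtNyP l : is_cone G -> G l ->
  ray_lim_gtNy f l <-> exists M, \forall t \near +oo, M <= f (t *: l).
Proof.
move=> Gcone Gl; split.
  move=> [a fa a_gt].
  have [M Ma] : exists M : R, (M%:E < a)%E.
    case: a a_gt {fa} => [r| |] // _; last by exists 0; rewrite ltry.
    by exists (r - 1); rewrite lte_fin gtrDl.
  exists M.
  have /fa : nbhs a [set y | (M%:E < y)%E].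
    by apply: open_nbhs_nbhs; split=> //; exact: open_ereal_gt_ereal.
  move=> aM; have {}aM : \forall t \near +oo, (M%:E < (f (t *: l))%:E)%E by [].
  by apply: filterS aM => t /ltW; rewrite lee_fin.
move=> [M fM]; have sl0 x : G x -> 0 <= grad_pair f x l.
  exact: grad_pair_ge0_of_ray_ge fM.
(* Truncating at t = 1 keeps the argument in the cone for every real t and makes
   g monotone on the whole line. *)
pose g t := (f (Num.max t 1 *: l))%:E.
have g_nd : {homo g : s t / s <= t >-> (s <= t)%E}.
  move=> s t st; rewrite lee_fin.
  have s1 : 0 < Num.max s 1 by rewrite lt_max ltr01 orbT.
  have t1 : 0 < Num.max t 1 by rewrite lt_max ltr01 orbT.
  have -> : Num.max t 1 *: l =
      Num.max s 1 *: l + (Num.max t 1 - Num.max s 1) *: l.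
    by rewrite -scalerDl addrC subrK.
  apply: le_of_grad_pair_ge0 => //; [|exact: Gcone|].
    by rewrite subr_ge0 ge_max !le_max st lexx !orbT.
  by rewrite -scalerDl addrC subrK; exact: Gcone.
exists (ereal_sup (range g)).
  apply: cvg_trans (nondecreasing_cvge g_nd); apply: near_eq_cvg.
  near=> t; rewrite /g max_l//; near: t; exact: nbhs_pinfty_ge.
apply: lt_le_trans (ltNyr (f (Num.max 0 1 *: l))) _.
by apply: ereal_sup_ubound; exists 0.
Unshelve. all: by end_near. Qed.

(** * Half lines in superlevel sets *)

(** A limit point of the superlevel set outside G would be a boundary point of G
    near which f takes values at least sigma, against the bound on the boundary
    values; inside G, closedness is the continuity of f. *)
Lemma closed_superlevel sigma : (sup_boundary G f < sigma%:E)%E ->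
  closed [set x | G x /\ sigma <= f x].
Proof.
move=> fs x xcl; have [Gx|nGx] := pselect (G x).
  split => //; rewrite leNgt; apply/negP => fx.
  have /xcl[y [[_ fy] /=]] : \forall y \near x, f y < sigma.
    exact: (cvgr_lt _ (f_continuous Gx) _ fx).
  by rewrite ltNge fy.
have bx : boundary G x.
  split; last by move=> /interior_subset.
  by apply: closure_subset xcl => y [].
have : (limf_esup (fun x => (f x)%:E) (within G (nbhs x)) < sigma%:E)%E.
  by apply: le_lt_trans fs; apply: ereal_sup_ubound; exists x.
move=> /ereal_inf_lt[_ [V xV <-] Vs].
have /xcl[y [[Gy fy] /(_ Gy) Vy]] := xV.
suff : (sigma%:E < sigma%:E)%E by rewrite ltxx.
apply: le_lt_trans Vs; apply: le_trans (ereal_sup_ubound (imageP _ Vy)).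
by rewrite lee_fin.
Qed.

(** The superlevel set is closed and convex, so the half line meets it in a
    closed segment starting at x.  Suppose that this segment has a last point z.
    If f(z) = sigma, then mu pairs nonnegatively with the gradient at z, and the
    gradient inequality at z gives f(x) <= sigma.  If f(z) > sigma, the half line
    stays in the superlevel set beyond z.  Both are absurd. *)
Lemma ray_in_superlevel sigma mu x t :
  (sup_boundary G f < sigma%:E)%E ->
  (forall y, level_set G f sigma y -> 0 <= grad_pair f y mu) ->
  G x -> sigma < f x -> 0 <= t ->
  G (x + t *: mu) /\ sigma <= f (x + t *: mu).
Proof.
move=> fs sl Gx fx t0.
set U := [set y | G y /\ sigma <= f y].
have Ucl : closed U by exact: closed_superlevel.
apply: contrapT => /= nUt.
pose T := [set s : R | 0 <= s /\ U (x + s *: mu)].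
have T0 : T 0 by split => //; rewrite scale0r addr0; split => //; exact: ltW.
have Tt : ubound T t.
  move=> s [s0 [Gs fsx]]; rewrite leNgt; apply/negP => ts; apply: nUt.
  have s_gt0 : 0 < s by exact: le_lt_trans ts.
  have r0 : 0 <= t / s by rewrite divr_ge0.
  have r1 : t / s <= 1 by rewrite ler_pdivrMr// mul1r ltW.
  have -> : x + t *: mu = (t / s) *: (x + s *: mu) + (1 - t / s) *: x.
    by apply/rowP => i; rewrite !mxE; field; rewrite gt_eqF.
  split; first exact: convex_set_mem.
  apply: le_trans (concave_function_ge f_concave r0 r1 Gs Gx).
  rewrite -[leLHS]mul1r -[X in X * _](subrK (t / s)) mulrDl addrC.
  by rewrite lerD// ler_wpM2l ?subr_ge0// ltW.
have Tsup : has_sup T by split; [exists 0|exists t].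
set m := sup T.
have line (s : R) : x + r *: mu @[r --> s] --> x + s *: mu.
  by apply: cvgD; [exact: cvg_cst|apply: cvgZr_tmp; exact: cvg_id].
have [m0 [Gm fm]] : T m.
  split; first by have := ub_le_sup Tsup.2 T0.
  apply: Ucl => B /line mB.
  by have [s [[_ Us] Bs]] := closure_sup Tsup.1 Tsup.2 mB; exists (x + s *: mu).
have {}fm : sigma < f (x + m *: mu).
  rewrite lt_neqAle fm andbT; apply/eqP => fmE.
  have := supergradient_le n_gt0 G_open G_convex f_concave
    (f_derivable Gm) Gm Gx.
  rewrite opprD addNKr -scaleNr grad_pairZ mulNr -fmE.
  by have := mulr_ge0 m0 (sl _ (conj Gm (esym fmE))); lra.
have nUm : \forall s \near m, U (x + s *: mu).
  apply: (line m); near=> y; split; first by near: y; exact: open_nbhs_nbhs.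
  by apply: ltW; near: y; exact: (cvgr_gt _ (f_continuous Gm) _ fm).
near m^'+ => s.
have ms : m < s by near: s; exact: nbhs_right_gt.
have Us : U (x + s *: mu) by near: s; exact: cvg_within nUm.
have : s <= m.
  apply: (ub_le_sup Tsup.2); split=> //; exact: ltW (le_lt_trans m0 ms).
by rewrite leNgt ms.
Unshelve. all: by end_near. Qed.

End OnOpenConvexSet.

End ConcaveFunctions.

(** * The maximal test cone *)

Lemma positive_cone_shift {R : realType} {n : nat} (y : 'rV[R]_n) :
  exists2 c : R, 0 <= c & positive_cone (y + c *: const_mx 1).
Proof.
have S0 : 0 <= \sum_(i < n) `|y ord0 i| by exact: sumr_ge0.
exists (1 + \sum_(i < n) `|y ord0 i|); first by rewrite addr_ge0.
move=> i; rewrite !mxE mulr1.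
have : `|y ord0 i| <= \sum_(i < n) `|y ord0 i|.
  by rewrite (bigD1 i)//= lerDl sumr_ge0.
by have := ler_norm (- y ord0 i); rewrite normrN; lra.
Qed.

Theorem theorem1p2 (R : realType) (n : nat) (hn : (2 <= n)%N)
  (G : set 'rV[R]_n) (f : 'rV[R]_n -> R) (S : set 'rV[R]_n)
  (G_proper : G `<` setT) (G_open : open G) (G_convex : convex_set G)
  (G_cone : is_cone G) (G_sym : symmetric_set G)
  (G_boundary : boundary G !=set0) (G_pos : positive_cone `<=` G)
  (f_smooth : smooth_on G f) (f_sym : symmetric_fun G f)
  (f_concave : concave_function G f)
  (f_ray : forall x, positive_cone x -> ray_lim_gtNy f x)
  (S_sym : symmetric_set S)
  (S_sub : S `<=` [set x | G x /\ ((f x)%:E < sup_on G f)%E])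
  (S_level : exists sigma : R,
    [/\ (sup_boundary G f < sigma%:E)%E, (sigma%:E < sup_on G f)%E &
        level_set G f sigma `<=` S]) :
  maximal_test_cone S f = closure (asymptotical_cone G f).
Proof.
have n_gt0 : (0 < n)%N by exact: ltnW.
have fd x (Gx : G x) : forall i, derivable f x (delta_mx 0 i).
  exact: (f_smooth [::] _ Gx).2.
have fc x (Gx : G x) : {for x, continuous f} := (f_smooth [::] x Gx).1.
have asym_grad_pair l x :
    asymptotical_cone G f l -> G x -> 0 <= grad_pair f x l.
  move=> [Gl /(ray_lim_gtNyP n_gt0 G_open G_convex f_concave fd G_cone Gl)].
  move=> [M fM] Gx.
  by apply: (grad_pair_ge0_of_ray_ge n_gt0 G_open G_convex f_concave fd Gl
    G_cone fM).
apply/seteqP; split; last first.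
  move=> mu mucl x Sx; rewrite leNgt; apply/negP => sl0.
  have [Gx _] := S_sub _ Sx.
  have /mucl[l [lA /=]] : \forall l \near mu, grad_pair f x l < 0.
    exact: (cvgr_lt _ (@grad_pair_continuous _ _ f x mu) _ sl0).
  by rewrite ltNge asym_grad_pair.
move=> mu muS.
have [sigma [fb fsup Ssigma]] := S_level.
have [_ [y Gy <-] fy] := ereal_sup_gt fsup; rewrite lte_fin in fy.
have pos_asym x : positive_cone x -> asymptotical_cone G f x.
  by move=> x0; split; [exact: G_pos|exact: f_ray].
have [c c0 x_pos] := positive_cone_shift y.
set x := y + _ in x_pos.
have Gx := G_pos _ x_pos.
have fx : sigma < f x.
  apply: lt_le_trans fy _.
  apply: (le_of_grad_pair_ge0 n_gt0 G_open G_convex f_concave fd) => // z.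
  by apply: asym_grad_pair; apply: pos_asym => i; rewrite mxE.
have fsx s : 1 <= s -> G (s *: x) /\ sigma < f (s *: x).
  move=> s1; have Gsx : G (s *: x).
    by apply: G_cone => //; exact: lt_le_trans s1.
  split=> //; apply: lt_le_trans fx _.
  have sE : s *: x = x + (s - 1) *: x by rewrite scalerBl scale1r addrC subrK.
  rewrite sE; rewrite sE in Gsx.
  apply: (le_of_grad_pair_ge0 n_gt0 G_open G_convex f_concave fd) => //.
    by move=> z; apply: asym_grad_pair; exact: pos_asym.
  by rewrite subr_ge0.
have ray s t : 1 <= s -> 0 <= t ->
    G (s *: x + t *: mu) /\ sigma <= f (s *: x + t *: mu).
  move=> /fsx[Gsx fsx'] t0.
  apply: (ray_in_superlevel n_gt0 G_open G_convex f_concave fd fc fb) => //.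
  by move=> z /Ssigma; exact: muS.
have muA e : 0 < e -> asymptotical_cone G f (mu + e *: x).
  move=> e0; have GA : G (mu + e *: x).
    (* x + mu / e is on the half line of direction mu issued from x. *)
    have -> : mu + e *: x = e *: (1 *: x + e^-1 *: mu).
      by apply/rowP => i; rewrite !mxE; field; rewrite gt_eqF.
    by apply: G_cone => //; apply: (ray _ _ _ _).1; rewrite ?invr_ge0// ltW.
  split => //.
  apply/(ray_lim_gtNyP n_gt0 G_open G_convex f_concave fd G_cone GA).
  (* For e t >= 1, t (mu + e x) = (e t) x + t mu is on the one issued from
     (e t) x. *)
  exists sigma; near=> t.
  have t1 : e^-1 <= t by near: t; apply: nbhs_pinfty_ge; rewrite num_real.
  rewrite scalerDr scalerA addrC; apply: (ray _ _ _ _).2.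
    by rewrite -ler_pdivrMr// mul1r.
  by apply: le_trans t1; rewrite invr_ge0 ltW.
move=> B muB.
have cvge : mu + e *: x @[e --> (0 : R)^'+] --> mu.
  apply: cvg_at_right_filter.
  rewrite -[X in _ --> X](_ : mu + 0 *: x = mu); last by rewrite scale0r addr0.
  by apply: cvgD; [exact: cvg_cst|apply: cvgZr_tmp; exact: cvg_id].
near ((0 : R)^'+) => e.
exists (mu + e *: x); split; last by near: e; exact: cvge.
by apply: muA; near: e; exact: nbhs_right_gt.
Unshelve. all: by end_near. Qed.
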